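(* Let $n,r$ be positive integers such that $G(n,r,0)$ has at least one edge. Then $$q^*(G(n,r,0))\le\frac{r}{n-r}.$$
   Context: For integers $n,r,s$, the Johnson graph $G(n,r,s)$ has as vertices all vectors $v\in\{0,1\}^n$ with exactly $r$ ones; two vertices are joined by an edge if and only if their inner product equals $s$. Modularity: for a graph $G$ with $e(G)\geq 1$ edges and a partition $\mathcal{A}$ of its vertex set, $q(\mathcal{A})=\sum_{A\in\mathcal{A}}\frac{e(A)}{e(G)}-\sum_{A\in\mathcal{A}}\frac{(\sum_{v\in A}\deg(v))^2}{4e(G)^2}$, where $e(A)$ is the number of edges of $G$ with both endpoints in $A$. The modularity of $G$ is $q^*(G)=\max_{\mathcal{A}}q(\mathcal{A})$, over all partitions of the vertex set. *)

(* Defs.v *)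
From mathcomp Require Import all_boot all_order all_algebra.

Set Implicit Arguments.
Unset Strict Implicit.
Unset Printing Implicit Defensive.

Import Order.TTheory GRing.Theory Num.Theory.

Record sgraph := SGraph {
  vertex :> finType;
  adj : rel vertex;
  adj_sym : symmetric adj;
  adj_irrefl : irreflexive adj
}.

Section Modularity.
Variable G : sgraph.

(* An edge is an unordered pair, so each one is counted once. *)
Definition edges : {set {set G}} :=
  [set [set p.1; p.2] | p in [set p : G * G | adj p.1 p.2]].

Definition num_edges : nat := #|edges|.

Definition edges_in (A : {set G}) : nat := #|[set e in edges | e \subset A]|.

Definition deg (v : G) : nat := #|[set w | adj v w]|.

Definition volume (A : {set G}) : nat := \sum_(v in A) deg v.

Local Open Scope ring_scope.

Definition mod_score (P : {set {set G}}) : rat :=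
  \sum_(A in P) (edges_in A)%:R / num_edges%:R
  - \sum_(A in P) (volume A)%:R ^+ 2 / (4 * num_edges%:R ^+ 2).

Definition discrete_partition : {set {set G}} := [set [set x] | x in [set: G]].

(* The initial value of the iterated maximum is the score of an actual
   partition, so this is the maximum over all partitions even when it is
   negative. *)
Definition modularity : rat :=
  \big[Num.max/mod_score discrete_partition]_(P : {set {set G}}
     | partition P [set: G]) mod_score P.

Lemma discrete_partitionP : partition discrete_partition [set: G].
Proof.
apply/and3P; split.
- apply/eqP/setP=> x; rewrite inE; apply/bigcupP; exists [set x].
    by apply: imset_f; rewrite inE.
  by rewrite inE.
- apply/trivIsetP=> _ _ /imsetP[x _ ->] /imsetP[y _ ->] nxy.
  rewrite disjoints1 inE; apply: contraNN nxy => /eqP->.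
  exact: eqxx.
- by apply/imsetP=> -[x _ /setP/(_ x)]; rewrite !inE eqxx.
Qed.

Lemma mod_score_le_modularity (P : {set {set G}}) :
  partition P [set: G] -> mod_score P <= modularity.
Proof. by move=> partP; apply: le_bigmax_cond. Qed.

Lemma modularity_attained :
  exists2 P : {set {set G}}, partition P [set: G] & modularity = mod_score P.
Proof.
rewrite /modularity; apply: (big_ind (fun m : rat =>
  exists2 P : {set {set G}}, partition P [set: G] & m = mod_score P)).
- by exists discrete_partition => //; apply: discrete_partitionP.
- move=> x y [P pP ->] [Q pQ ->].
  by case: (leP (mod_score P) (mod_score Q)) => _; [exists Q | exists P].
- by move=> P pP; exists P.
Qed.

End Modularity.

Section Johnson.
Variables n r s : nat.

Definition dot (v w : {ffun 'I_n -> bool}) : nat := \sum_(i < n) v i * w i.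

Definition johnson_vertex : finType :=
  {v : {ffun 'I_n -> bool} | \sum_(i < n) v i == r}.

(* Edges join distinct vertices; the first conjunct matters only if s = r. *)
Definition johnson_adj : rel johnson_vertex :=
  fun v w => (v != w) && (dot (val v) (val w) == s).

Lemma johnson_adj_sym : symmetric johnson_adj.
Proof.
move=> v w; rewrite /johnson_adj eq_sym; congr (_ && (_ == _)).
by apply: eq_bigr => i _; rewrite mulnC.
Qed.

Lemma johnson_adj_irrefl : irreflexive johnson_adj.
Proof. by move=> v; rewrite /johnson_adj eqxx. Qed.

Definition johnson : sgraph := SGraph johnson_adj_sym johnson_adj_irrefl.

End Johnson.

(* Main.v *)
Require Import Defs.
From mathcomp Require Import all_boot all_order all_algebra.
From mathcomp Require Import ring lra zify.

Set Implicit Arguments.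
Unset Strict Implicit.
Unset Printing Implicit Defensive.

Import Order.TTheory GRing.Theory Num.Theory.
Local Open Scope ring_scope.

(* For a D-regular graph on N vertices, the score of a partition is at most
   L / D as soon as the adjacency form is bounded by L on vectors of sum zero:
   apply this to the centred indicators of the parts. For G(n, r, 0) one can
   take L = C(n - r - 1, r - 1) = D r / (n - r), as follows. Since B is disjoint
   from A iff B lies in the complement of A, the adjacency operator is, up to
   complementation and the factor (n - 2r)!, the (n - 2r)-th iterate of the
   operator U taking functions on k-sets to functions on (k+1)-sets. The relation
   U* U = U U* + (n - 2k) on k-sets gives |U f|^2 <= k (n - k - 1) |f|^2 for f
   of sum zero, by induction on k, and the product of these bounds for
   r <= k < n - r is ((n - 2r)! L)^2. *)

(** * Up and down operators on the layers of the subset lattice *)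

Section Layers.
Variables (R : realFieldType) (T : finType).
Implicit Types (f g : {set T} -> R) (A B : {set T}) (k m : nat).

(** Functions live on all subsets and only this form selects a layer, so that U, here [layer_up],
    can be iterated without changing type. *)
Definition layer_dot k f g : R := \sum_(A : {set T} | #|A| == k) f A * g A.

Definition layer_up f : {set T} -> R := fun B => \sum_(b in B) f (B :\ b).

Definition layer_down f : {set T} -> R := fun A => \sum_(a in ~: A) f (a |: A).

Lemma layer_dot_ge0 k f : 0 <= layer_dot k f f.
Proof. by apply: sumr_ge0 => A _; rewrite -expr2 sqr_ge0. Qed.

(** Both sides run over pairs of a k-set A and a point b outside it, with B = [b |: A]. *)
Lemma layer_dot_up k f g :
  layer_dot k.+1 (layer_up f) g = layer_dot k f (layer_down g).
Proof.
rewrite /layer_dot /layer_up /layer_down.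
under eq_bigr do rewrite mulr_suml.
under [RHS]eq_bigr do rewrite mulr_sumr.
rewrite (exchange_big_dep predT) //= [RHS](exchange_big_dep predT) //=.
apply: eq_bigr => b _.
rewrite (reindex_onto (fun A : {set T} => b |: A) (fun B => B :\ b)) /=; last first.
  by move=> B /andP[_ bB]; rewrite setD1K.
apply: eq_big => [A|A /andP[_ /eqP->] //].
rewrite setU11 andbT inE cardsU1; apply/andP/andP => [[kA /eqP eA]|[kA nbA]].
  have nbA : b \notin A by rewrite -eA !inE eqxx.
  by rewrite nbA add1n eqSS in kA.
by rewrite nbA add1n eqSS kA setU1K ?eqxx.
Qed.

(** Adding then removing a point and removing then adding one share the swap terms [S]; they differ
    only in how often they return to A, [#|~: A|] times against [#|A|] times. *)
Lemma layer_downK f A :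
  layer_down (layer_up f) A =
    layer_up (layer_down f) A + (#|T|%:R - 2 * #|A|%:R) * f A.
Proof.
pose S := \sum_(a in ~: A) \sum_(b in A) f ((a |: A) :\ b).
have -> : layer_down (layer_up f) A = #|~: A|%:R * f A + S.
  rewrite /layer_down /layer_up mulr_natl -sumr_const -big_split /=.
  apply: eq_bigr => a; rewrite inE => naA.
  by rewrite big_setU1 //= setU1K.
have -> : layer_up (layer_down f) A = #|A|%:R * f A + S.
  rewrite /layer_down /layer_up mulr_natl -sumr_const /S exchange_big -big_split /=.
  apply: eq_bigr => b bA.
  rewrite (bigD1 b) /= ?inE ?eqxx // setD1K //; congr (_ + _).
  apply: eq_big => a; rewrite !inE.
    by have [->|] := eqVneq a b; rewrite ?bA //= andbT.
  case/andP => _ nab; congr f; apply/setP=> x; rewrite !inE.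
  by have [->|] := eqVneq x a; rewrite ?nab.
have := cardsC A => /(congr1 (fun n => n%:R : R)); rewrite natrD => <-; ring.
Qed.

Lemma layer_dot_subl k f g c :
  layer_dot k (fun A => c * f A - g A) (fun A => c * f A - g A) =
  c ^+ 2 * layer_dot k f f - 2 * c * layer_dot k f g + layer_dot k g g.
Proof.
rewrite /layer_dot !mulr_sumr -sumrB -big_split /=.
by apply: eq_bigr => A _; ring.
Qed.

(** Passes a norm bound to the adjoint: a stands for |f|^2 and b for |U* f|^2 = (f, U U* f). The
    quadratic is tested at its minimum t = b / a. *)
Lemma le_of_square_defect (a b c : R) :
  0 <= a -> 0 <= b -> 0 <= c ->
  (forall t, 0 <= t ^+ 2 * a - 2 * t * b + c * b) -> b <= c * a.
Proof.
move=> a0 b0 c0 H; have [a_eq0|a_neq0] := eqVneq a 0.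
  (* At a = 0, the choice t = c + 1 leaves -(c + 2) b >= 0. *)
  by have := H (c + 1); rewrite a_eq0 !mulr0; nra.
have a_gt0 : 0 < a by rewrite lt_def a_neq0.
have := H (b / a).
have -> : (b / a) ^+ 2 * a - 2 * (b / a) * b + c * b = b / a * (c * a - b).
  by field.
have [->|b_neq0] := eqVneq b 0; first by move=> _; apply: mulr_ge0.
have b_gt0 : 0 < b by rewrite lt_def b_neq0.
by rewrite pmulr_rge0 ?subr_ge0 // divr_gt0.
Qed.

(* In the step from k to k + 1, the commutation relation reduces the claim to a
   bound on [layer_down] from level k + 1 to level k, the adjoint of the operator
   bounded by the induction hypothesis. *)
Lemma layer_up_gap k f : (k < #|T|)%N ->
  layer_dot k f (fun=> 1) = 0 ->
  layer_dot k.+1 (layer_up f) (layer_up f) <=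
    k%:R * (#|T|%:R - k%:R - 1) * layer_dot k f f.
Proof.
have comm h j : layer_dot j.+1 (layer_up h) (layer_up h) =
    layer_dot j h (layer_up (layer_down h)) +
      (#|T|%:R - 2 * j%:R) * layer_dot j h h.
  rewrite layer_dot_up /layer_dot mulr_sumr -big_split /=; apply: eq_bigr => A.
  move=> /eqP cA; rewrite layer_downK cA; ring.
elim: k f => [|k IHk] f ltk f0; rewrite comm.
  (* Level 0 contains only the empty set, so sum zero forces f to vanish there. *)
  have fz A : #|A| = 0 -> f A = 0.
    move=> /eqP; rewrite cards_eq0 => /eqP->.
    move: f0; rewrite /layer_dot (bigD1 set0) ?cards0 //= big1 ?addr0 ?mulr1 //.
    by move=> B; rewrite cards_eq0 => /andP[/eqP->]; rewrite eqxx.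
  rewrite /layer_dot !big1 ?mulr0 ?addr0 ?lexx // => A /eqP/fz->; rewrite ?mul0r //.
set g := layer_down f.
have fUg h : layer_dot k.+1 f (layer_up h) = layer_dot k h g.
  by rewrite -layer_dot_up; apply: eq_bigr => A _; rewrite mulrC.
have g0 : layer_dot k g (fun=> 1) = 0.
  have -> : layer_dot k g (fun=> 1) = layer_dot k.+1 f (layer_up (fun=> 1)).
    by rewrite fUg; apply: eq_bigr => A _; rewrite mulrC.
  (* U maps the constant 1 to the constant k + 1 on (k + 1)-sets. *)
  transitivity (k.+1%:R * layer_dot k.+1 f (fun=> 1)); last by rewrite f0 mulr0.
  rewrite /layer_dot mulr_sumr; apply: eq_bigr => A /eqP cA.
  by rewrite /layer_up sumr_const cA mulr1 mulrC.
have ltkn : k.+2%:R <= #|T|%:R :> R by rewrite ler_nat.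
have c0 : 0 <= k%:R * (#|T|%:R - k%:R - 1) :> R.
  by apply: mulr_ge0 => //; move: ltkn; rewrite -addn2 natrD; lra.
have : layer_dot k g g <= k%:R * (#|T|%:R - k%:R - 1) * layer_dot k.+1 f f.
  apply: le_of_square_defect; rewrite ?layer_dot_ge0 // => t.
  apply: (le_trans (layer_dot_ge0 k.+1 (fun A => t * f A - layer_up g A))).
  rewrite layer_dot_subl fUg lerD2l; exact: IHk (ltnW ltk) g0.
(* With n = [#|T|], k (n - k - 1) + n - 2 (k + 1) = (k + 1) (n - k - 2). *)
rewrite fUg -addn1 natrD; lra.
Qed.

Lemma layer_up_mean0 k f :
  layer_dot k f (fun=> 1) = 0 -> layer_dot k.+1 (layer_up f) (fun=> 1) = 0.
Proof.
move=> f0; rewrite layer_dot_up.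
transitivity (layer_dot k f (fun=> 1) * (#|T|%:R - k%:R)); last by rewrite f0 mul0r.
rewrite /layer_dot mulr_suml; apply: eq_bigr => A /eqP cA.
rewrite /layer_down sumr_const -(cardsC A) natrD cA; ring.
Qed.

(** The factorial counts the orders in which the m points of [B :\: A] can be removed. *)
Lemma iter_layer_upE m f B :
  iter m layer_up f B =
    m`!%:R * \sum_(A : {set T} | (A \subset B) && (#|A| + m == #|B|)%N) f A.
Proof.
elim: m B => [|m IHm] B /=.
  rewrite mul1r (big_pred1 B) // => A; rewrite addn0 /=.
  apply/andP/eqP => [[sAB /eqP cA]|->]; last by [].
  by apply/eqP; rewrite eqEcard sAB cA leqnn.
rewrite -[LHS]/(\sum_(b in B) iter m layer_up f (B :\ b)).
rewrite (eq_bigr _ (fun b _ => IHm (B :\ b))).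
rewrite -mulr_sumr factS mulnC natrM -mulrA; congr (_ * _).
rewrite (exchange_big_dep (fun A : {set T} => (A \subset B) && (#|A| + m.+1 == #|B|)%N)) /=.
  rewrite mulr_sumr; apply: eq_bigr => A /andP[sAB /eqP cA].
  rewrite (eq_bigl (mem (B :\: A))) => [|b]; last first.
    rewrite !inE subsetD1 sAB andbC /=.
    case bB: (b \in B); rewrite ?andbF //= andbT.
    have := cardsD1 b B; rewrite bB -cA addnS add1n => -[<-].
    by rewrite eqxx andbT.
  rewrite sumr_const cardsD (setIidPr sAB) -cA addKn mulr_natl //.
move=> b A bB /andP[]; rewrite subsetD1 => /andP[-> _].
by have := cardsD1 b B; rewrite bB add1n addnS => -> /eqP->; rewrite eqxx.
Qed.

Lemma iter_layer_up_gap k m f : (k + m <= #|T|)%N ->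
  layer_dot k f (fun=> 1) = 0 ->
  layer_dot (k + m) (iter m layer_up f) (iter m layer_up f) <=
    (\prod_(i < m) ((k + i) * (#|T| - k - 1 - i)))%:R * layer_dot k f f.
Proof.
move=> lem f0; elim: m lem => [|m IHm] lem.
  by rewrite big_ord0 mul1r addn0.
have mean0 : layer_dot (k + m) (iter m layer_up f) (fun=> 1) = 0.
  elim: {lem IHm} m => [|m IHm]; first by rewrite addn0.
  by rewrite addnS /=; apply: layer_up_mean0.
rewrite addnS in lem *.
apply: (le_trans (layer_up_gap lem mean0)).
rewrite big_ord_recr /= natrM [X in _ <= X * _]mulrC -[leRHS]mulrA.
have -> : (((k + m) * (#|T| - k - 1 - m))%:R : R)
    = (k + m)%:R * (#|T|%:R - (k + m)%:R - 1).
  rewrite natrM -!subnDA natrB; last lia.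
  by rewrite !natrD; ring.
apply: ler_wpM2l; last by apply: IHm; lia.
apply: mulr_ge0 => //.
have : (k + m).+1%:R <= #|T|%:R :> R by rewrite ler_nat.
by rewrite -addn1 natrD; lra.
Qed.

(** Reversing the index turns k + i into n - k - 1 - i, so both factors give the same falling
    factorial, (n - 2k)! C(n - k - 1, n - 2k); the symmetry of binomials does the rest. *)
Lemma prod_gap_bin n k : (0 < k)%N -> (k.*2 <= n)%N ->
  (\prod_(i < n - k.*2) ((k + i) * (n - k - 1 - i)) =
     ((n - k.*2)`! * 'C(n - k - 1, k - 1)) ^ 2)%N.
Proof.
move=> k0 le2k; rewrite big_split /=.
rewrite (reindex_inj rev_ord_inj) /=.
rewrite (eq_bigr (fun i : 'I_(n - k.*2) => n - k - 1 - i)%N); last first.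
  by move=> i _; have := ltn_ord i; lia.
rewrite -ffact_prod -bin_ffact mulnn mulnC; congr (_ ^ 2)%N; congr (_ * _)%N.
by rewrite -bin_sub; [congr 'C(_, _)|]; lia.
Qed.

Lemma disjoint_form_gap k f : (0 < k)%N -> (k.*2 <= #|T|)%N ->
  layer_dot k f (fun=> 1) = 0 ->
  \sum_(A : {set T} | #|A| == k)
     \sum_(B : {set T} | (#|B| == k) && [disjoint A & B]) f A * f B <=
  'C(#|T| - k - 1, k - 1)%:R * layer_dot k f f.
Proof.
move=> k0 le2k f0; set L := 'C(_, _); set m := (#|T| - k.*2)%N.
pose Mf (A : {set T}) := \sum_(B : {set T} | (#|B| == k) && [disjoint A & B]) f B.
have -> : \sum_(A : {set T} | #|A| == k)
    \sum_(B : {set T} | (#|B| == k) && [disjoint A & B]) f A * f B = layer_dot k f Mf.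
  by apply: eq_bigr => A _; rewrite mulr_sumr.
(* For B inside [~: A], the condition |B| + m = n - k says exactly |B| = k. *)
have MfE A : #|A| = k -> iter m layer_up f (~: A) = m`!%:R * Mf A.
  move=> cA; rewrite iter_layer_upE; congr (_ * _); apply: eq_bigl => B.
  rewrite subsets_disjoint setCK disjoint_sym andbC; congr (_ && _).
  by have := cardsC A; rewrite cA /m; lia.
have L_gt0 : 0 < L%:R :> R by rewrite ltr0n bin_gt0; lia.
have bound : layer_dot k Mf Mf <= L%:R ^+ 2 * layer_dot k f f.
  have := @iter_layer_up_gap k m f _ f0.
  rewrite prod_gap_bin // -/m -/L => /(_ ltac:(lia)).
  have -> : layer_dot (k + m) (iter m layer_up f) (iter m layer_up f) =
      m`!%:R ^+ 2 * layer_dot k Mf Mf.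
    rewrite /layer_dot (reindex_inj (@setC_inj T)) mulr_sumr /=.
    rewrite (eq_bigl (fun A : {set T} => #|A| == k)) => [|A]; last first.
      by have := cardsC A; rewrite /m; lia.
    by apply: eq_bigr => A /eqP cA; rewrite MfE //; ring.
  rewrite natrX natrM exprMn -[leRHS]mulrA ler_pM2l // exprn_gt0 // ltr0n; exact: fact_gt0.
(* Cauchy-Schwarz in expanded form: 0 <= |L f - Mf|^2 <= 2 L^2 |f|^2 - 2 L (f, Mf), then divide by 2
   L. *)
have := layer_dot_ge0 k (fun A => L%:R * f A - Mf A).
rewrite layer_dot_subl => defect.
rewrite -(ler_pM2l L_gt0); move: defect bound; rewrite expr2; lra.
Qed.

End Layers.

(** * Edge counts and the modularity of regular graphs *)

Section Graphs.
Variable G : sgraph.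
Implicit Types A : {set G}.

(** Each edge inside A comes from exactly two ordered pairs, (x, y) and (y, x), which differ by
    irreflexivity. *)
Lemma handshake_in A :
  ((edges_in A).*2 = \sum_(v in A) #|[set w in A | adj v w]|)%N.
Proof.
pose P := [set p : G * G | [&& p.1 \in A, p.2 \in A & adj p.1 p.2]].
pose h (p : G * G) := [set p.1; p.2].
have -> : (\sum_(v in A) #|[set w in A | adj v w]| = \sum_(p in P) 1)%N.
  under eq_bigr do rewrite -sum1dep_card.
  by rewrite pair_big_dep /=; apply: eq_bigl => p; rewrite inE.
have hP : [set e in edges G | e \subset A] = h @: P.
  apply/setP => e; rewrite inE; apply/andP/imsetP => [[/imsetP[p]]|[p]].
    rewrite inE => adjp -> sA; exists p => //.
    by move: sA; rewrite inE adjp andbT subUset !sub1set.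
  rewrite inE => /and3P[pA qA adjp] ->; split.
    by apply/imsetP; exists p; rewrite ?inE.
  by rewrite subUset !sub1set pA.
rewrite (partition_big_imset h) /= -hP -muln2 -sum_nat_const.
apply: eq_bigr => e; rewrite hP => /imsetP[[x y]].
rewrite inE /= => /and3P[xA yA xy] ->.
have nxy : x != y by apply: contraTneq xy => ->; rewrite adj_irrefl.
rewrite (eq_bigl [in [set (x, y); (y, x)]]) => [|[u v]]; last first.
  rewrite !inE /h /= !xpair_eqE; apply/andP/orP => [[/and3P[uA vA uv] /eqP eqh]|].
    have nuv : u != v by apply: contraTneq uv => ->; rewrite adj_irrefl.
    have : u \in [set x; y] by rewrite -eqh set21.
    have : v \in [set x; y] by rewrite -eqh set22.
    rewrite !inE => /orP[]/eqP ev /orP[]/eqP eu;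
      by rewrite eu ev ?eqxx in nuv *; auto.
  case=> /andP[/eqP-> /eqP->]; first by rewrite xA yA xy.
  by rewrite xA yA adj_sym xy setUC.
by rewrite sum1_card cards2 xpair_eqE negb_and nxy.
Qed.

Lemma handshake : ((num_edges G).*2 = \sum_(v : G) deg v)%N.
Proof.
have -> : num_edges G = edges_in [set: G].
  by apply: eq_card => e; rewrite inE subsetT andbT.
rewrite handshake_in; apply: eq_big => [v|v _]; first by rewrite inE.
by apply: eq_card => w; rewrite !inE.
Qed.

(* In a D-regular graph on N vertices, a part A contributes
   2 e(A) / (D N) - (|A| / N)^2 to the modularity score. *)
Lemma modularity_le_regular (D : nat) (L : rat) :
  (0 < num_edges G)%N -> (forall v : G, deg v = D) ->
  (forall A, 2 * (edges_in A)%:R <= D%:R * #|A|%:R ^+ 2 / #|G|%:R + L * #|A|%:R) ->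
  modularity G <= L / D%:R.
Proof.
move=> e_gt0 degD bound.
have E2 : 2 * (num_edges G)%:R = D%:R * #|G|%:R :> rat.
  rewrite -!natrM mul2n handshake.
  by rewrite (eq_bigr _ (fun v _ => degD v)) sum_nat_const mulnC.
have E0 : 0 < (num_edges G)%:R :> rat by rewrite ltr0n.
have DN0 : D%:R * #|G|%:R != 0 :> rat by rewrite -E2; lra.
have [D0 N0] : D%:R != 0 :> rat /\ #|G|%:R != 0 :> rat.
  by move: DN0; rewrite mulf_eq0 negb_or => /andP.
have DN_gt0 : 0 < D%:R * #|G|%:R :> rat by rewrite -E2; lra.
(* The bound is spread evenly over the vertices, so that it can be compared with the score part by
   part. *)
have -> : L / D%:R = \sum_(v : G) L / (D%:R * #|G|%:R).
  by rewrite sumr_const -[RHS]mulr_natr; field; rewrite N0 D0.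
have [P partP ->] := modularity_attained G.
rewrite /mod_score -sumrB.
rewrite (eq_bigl [in [set: G]]) => [|v]; last by rewrite inE.
rewrite (set_partition_big _ partP) /=; apply: ler_sum => A _.
have -> : volume A = (D * #|A|)%N.
  by rewrite /volume; under eq_bigr do rewrite degD; rewrite sum_nat_const mulnC.
have -> : (num_edges G)%:R = D%:R * #|G|%:R / 2 :> rat by lra.
rewrite sumr_const -(mulr_natr (L / _)) natrM.
rewrite -(ler_pM2l DN_gt0).
have := bound A; set e := _%:R => bA; rewrite -subr_ge0 in bA.
rewrite -subr_ge0; apply: (le_trans bA); rewrite le_eqVlt; apply/orP; left.
by apply/eqP; field; rewrite N0.
Qed.

End Graphs.

(** * G(n, r, 0) as the disjointness graph of r-sets *)

Section Kneser.
Variables n r : nat.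
Hypothesis r_gt0 : (0 < r)%N.
Let K := johnson n r 0.
Implicit Types v w : K.

Definition support v : {set 'I_n} := [set i | val v i].

Lemma card_support v : #|support v| = r.
Proof.
have /eqP <- := valP v; rewrite -sum1dep_card big_mkcond.
by apply: eq_bigr => i _; case: (val v i).
Qed.

Lemma support_inj : injective support.
Proof.
move=> v w /setP e; apply/val_inj/ffunP => i.
by have := e i; rewrite !inE.
Qed.

Lemma support_surj (S : {set 'I_n}) : #|S| = r -> exists v, support v = S.
Proof.
move=> cS; have sumS : (\sum_(i < n) [ffun i => i \in S] i == r)%N.
  rewrite -cS -sum1_card [X in _ == X]big_mkcond; apply/eqP.
  by apply: eq_bigr => i _; rewrite ffunE; case: (i \in S).
by exists (Sub [ffun i => i \in S] sumS); apply/setP=> i; rewrite inE SubK ffunE.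
Qed.

Lemma adj_support v w : adj v w = [disjoint support v & support w].
Proof.
have dotE : (dot (val v) (val w) == 0%N) = [disjoint support v & support w].
  rewrite /dot sum_nat_eq0 disjoint_subset.
  apply/forallP/subsetP => [H i|H i].
    rewrite !inE => vi; have := H i; rewrite vi /= mul1n; by case: (val w i).
  by have := H i; rewrite !inE; case: (val v i); case: (val w i) => // /(_ isT).
(* For v = w, both sides are false: a support has r > 0 points and meets itself. *)
rewrite /= /johnson_adj dotE; have [->|//] := eqVneq v w.
rewrite /= -setI_eq0 setIid -cards_eq0 card_support; by case: r r_gt0.
Qed.

Lemma big_support (V : nmodType) (F : {set 'I_n} -> V) (P : pred {set 'I_n}) :
  \sum_(S : {set 'I_n} | (#|S| == r) && P S) F S =
  \sum_(v : K | P (support v)) F (support v).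
Proof.
rewrite -(big_imset (h := support) (A := [pred v | P (support v)])) /=; last first.
  by move=> v w _ _; apply: support_inj.
apply: eq_bigl => S; apply/andP/imsetP => [[/eqP/support_surj[v <-] PS]|[v Pv ->]].
  by exists v.
by rewrite card_support.
Qed.

Lemma card_kneser : #|K| = 'C(n, r).
Proof.
rewrite -[n in RHS]card_ord -card_draws -[RHS]sum1dep_card -[LHS]sum1_card.
have := big_support (fun=> 1%N) xpredT => /= <-.
by apply: eq_bigl => S; rewrite andbT.
Qed.

(** The neighbours are the r-subsets of the complement of the support. *)
Lemma deg_kneser v : deg v = 'C(n - r, r).
Proof.
have -> : (n - r = #|~: support v|)%N.
  by have := cardsC (support v); rewrite card_support card_ord; lia.
rewrite -cards_draws /deg -!sum1dep_card.
have := big_support (fun=> 1%N) (fun S => S \subset ~: support v) => /= H.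
rewrite (eq_bigl _ _ (fun S => andbC _ _)) H; apply: eq_bigl => w.
by rewrite -disjoints_subset disjoint_sym -adj_support.
Qed.

Lemma kneser_edges_in (A : {set K}) : (r.*2 <= n)%N ->
  2 * (edges_in A)%:R <=
    'C(n - r, r)%:R * #|A|%:R ^+ 2 / #|K|%:R + 'C(n - r - 1, r - 1)%:R * #|A|%:R :> rat.
Proof.
move=> le2r; set D := 'C(n - r, r); set L := 'C(_ - 1, _).
have N0 : #|K|%:R != 0 :> rat.
  by rewrite pnatr_eq0 card_kneser -lt0n bin_gt0; lia.
(* c is the density of A, which makes its centred indicator f have sum zero. *)
pose c : rat := #|A|%:R / #|K|%:R.
pose f (S : {set 'I_n}) : rat := (S \in support @: A)%:R - c.
have fE v : f (support v) = (v \in A)%:R - c.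
  by rewrite /f mem_imset //; apply: support_inj.
have sumA : \sum_(v : K) (v \in A)%:R = #|A|%:R :> rat.
  by rewrite -sumr_const [RHS]big_mkcond; apply: eq_bigr => v _; case: (v \in A).
have sumc : \sum_(v : K) c = #|A|%:R.
  by rewrite sumr_const -[LHS]mulr_natr /c mulfVK.
have level F : \sum_(S : {set 'I_n} | #|S| == r) F S = \sum_(v : K) F (support v) :> rat.
  by rewrite -(big_support F xpredT); apply: eq_bigl => S; rewrite andbT.
have sumf : \sum_(v : K) ((v \in A)%:R - c) = 0 :> rat.
  by rewrite sumrB sumA sumc subrr.
have f0 : layer_dot r f (fun=> 1) = 0.
  rewrite /layer_dot level; apply: etrans sumf.
  by apply: eq_bigr => v _; rewrite mulr1 fE.
have ff : layer_dot r f f = #|A|%:R - c * #|A|%:R.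
  rewrite /layer_dot level.
  transitivity (\sum_(v : K) ((1 - c) * (v \in A)%:R - c * ((v \in A)%:R - c)) : rat).
    by apply: eq_bigr => v _; rewrite fE; case: (v \in A) => /=; ring.
  by rewrite sumrB -!mulr_sumr sumf sumA; ring.
have := @disjoint_form_gap rat 'I_n r f r_gt0; rewrite card_ord => /(_ le2r f0).
rewrite -/L ff level.
under eq_bigr => v _.
  rewrite (big_support (fun S => f (support v) * f S)
            (fun S => [disjoint support v & S])) /=.
  under eq_bigl do rewrite -adj_support.
  over.
have sumadj v : \sum_(w | adj v w) 1 = D%:R :> rat.
  by rewrite sumr_const /D -(deg_kneser v) /deg cardsE.
have -> : \sum_(v : K) \sum_(w | adj v w) f (support v) * f (support w) =
    2 * (edges_in A)%:R - c * D%:R * #|A|%:R :> rat.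
  have -> : 2 * (edges_in A)%:R =
      \sum_(v : K) \sum_(w | adj v w) (v \in A)%:R * (w \in A)%:R :> rat.
    rewrite -natrM mul2n handshake_in natr_sum big_mkcond.
    apply: eq_bigr => v _; rewrite -mulr_sumr; case: (v \in A); rewrite ?mul0r // mul1r.
    rewrite -sum1dep_card natr_sum.
    rewrite (eq_bigl (fun w => adj v w && (w \in A))) => [|w]; last by rewrite andbC.
    by rewrite big_mkcondr; apply: eq_bigr => w _; case: (w \in A).
  have -> : c * D%:R * #|A|%:R =
      \sum_(v : K) \sum_(w | adj v w) c * (w \in A)%:R.
    rewrite (exchange_big_dep predT) //= -sumA mulr_sumr; apply: eq_bigr => w _.
    rewrite -(sumadj w) mulr_sumr mulr_suml.
    by apply: eq_big => [v|v _]; [exact: adj_sym|ring].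
  (* Writing a, b for the indicators at v, w: (a - c) (b - c) = a b - c b - c (a - c). By regularity
     the last term sums to D c times the total of f, which is zero. *)
  transitivity (\sum_(v : K) \sum_(w | adj v w) ((v \in A)%:R * (w \in A)%:R
      - c * (w \in A)%:R) - \sum_(v : K) c * D%:R * ((v \in A)%:R - c)).
    rewrite -sumrB; apply: eq_bigr => v _.
    rewrite -[c * D%:R * _]mulrAC -(sumadj v) mulr_sumr -sumrB.
    by apply: eq_bigr => w _; rewrite !fE; ring.
  rewrite -mulr_sumr sumf mulr0 subr0 -sumrB; apply: eq_bigr => v _.
  by rewrite sumrB.
have -> : D%:R * #|A|%:R ^+ 2 / #|K|%:R = c * D%:R * #|A|%:R.
  by rewrite /c; field.
(* |f|^2 = |A| - c |A|; the bound keeps |A| and drops the rest. *)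
have : 0 <= c * (L%:R * #|A|%:R) by rewrite /c !mulr_ge0 // invr_ge0.
lra.
Qed.

End Kneser.

Theorem corollary3p1p1 (n r : nat) (hn : (0 < n)%N) (hr : (0 < r)%N)
    (hE : (1 <= num_edges (johnson n r 0))%N) :
  modularity (johnson n r 0) <= r%:R / (n%:R - r%:R).
Proof.
(* An edge provides two disjoint r-sets among n points. *)
have le2r : (r.*2 <= n)%N.
  have /card_gt0P[e /imsetP[[v w]]] := hE; rewrite inE => vw _.
  have dvw : [disjoint support v & support w] by rewrite -(adj_support hr).
  have := max_card [in support v :|: support w].
  rewrite card_ord cardsU (disjoint_setI0 dvw) cards0 !card_support; lia.
have D0 : 'C(n - r, r)%:R != 0 :> rat by rewrite pnatr_eq0 -lt0n bin_gt0; lia.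
have nr0 : n%:R - r%:R != 0 :> rat by rewrite -natrB ?pnatr_eq0; lia.
(* The absorption identity r C(n - r, r) = (n - r) C(n - r - 1, r - 1). *)
have -> : r%:R / (n%:R - r%:R) = 'C(n - r - 1, r - 1)%:R / 'C(n - r, r)%:R :> rat.
  apply/eqP; rewrite eqr_div // -natrB -?natrM ?eqr_nat; last lia.
  have := mul_bin_diag (n - r) (r - 1); by rewrite -[(n - r).-1]subn1 (_ : (r - 1).+1 = r)%N; lia.
apply: (modularity_le_regular hE (deg_kneser hr)) => A.
exact: kneser_edges_in.
Qed.
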